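(* For every instance of the reentrant flow shop problem with $m$ machines, $n$ jobs, unit processing times, loop numbers $\mathcal{L}_1,\dots,\mathcal{L}_n$ and weights $w_1,\dots,w_n>0$ (problem $F|reentry,\ p_{ijk}=1|\sum w_jC_j$), there is a non-interruptive schedule that minimizes the total weighted completion time $\sum_{j=1}^n w_jC_j$ among all schedules.
   Context: Reentrant flow shop with unit processing times: there are $m\ge 1$ machines in series and $n$ jobs. Job $j$ must traverse the shop $\mathcal{L}_j\ge 1$ times (loops $k=1,\dots,\mathcal{L}_j$, with $\mathcal{L}_j$ an integer) and has weight $w_j>0$. In each loop it is processed for one time unit on each of the machines $1,2,\dots,m$ in this order. Once a loop is started on machine $1$ it proceeds through all machines without waiting. A schedule is an assignment of start times $S_{jk}\in\{0,1,2,\dots\}$ on machine $1$ to all loops $(j,k)$ such that distinct loops have distinct start times and $S_{jk}\ge C_{j,k-1}$ for $k\ge 2$, where $C_{jk}=S_{jk}+m$ is the completion time of loop $k$ of job $j$ on machine $m$. The completion time of job $j$ is $C_j=C_{j\mathcal{L}_j}$. A schedule is non-interruptive if $S_{jk}=C_{j,k-1}$ for all $j=1,\dots,n$ and all $k=2,\dots,\mathcal{L}_j$. *)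

(* Defs.v *)
From mathcomp Require Import all_boot all_order all_algebra.

Set Implicit Arguments.
Unset Strict Implicit.
Unset Printing Implicit Defensive.

Import Order.TTheory GRing.Theory Num.Theory.

Section ReentrantFlowShop.

Variables (m n : nat) (L : 'I_n -> nat).

(* Loops keep their 1-based numbering, so the loops of job [j] are the pairs
   [(j, k)] with [1 <= k <= L j].  [S j k] is the start time of loop [(j, k)]
   on machine 1; the values of [S] outside this range are never used. *)
Definition is_loop (j : 'I_n) (k : nat) : bool := 1 <= k <= L j.

Definition start_times := 'I_n -> nat -> nat.

Definition loop_completion (S : start_times) (j : 'I_n) (k : nat) : nat :=
  S j k + m.

Definition is_schedule (S : start_times) : Prop :=
  (forall j k j' k', is_loop j k -> is_loop j' k' ->
     (j, k) <> (j', k') -> S j k <> S j' k') /\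
  (forall j k, 2 <= k <= L j -> loop_completion S j k.-1 <= S j k).

Definition non_interruptive (S : start_times) : Prop :=
  forall j k, 2 <= k <= L j -> S j k = loop_completion S j k.-1.

Definition job_completion (S : start_times) (j : 'I_n) : nat :=
  loop_completion S j (L j).

Definition total_weighted_completion (R : realFieldType) (w : 'I_n -> R)
    (S : start_times) : R :=
  (\sum_(j < n) w j * (job_completion S j)%:R)%R.

End ReentrantFlowShop.

(* Main.v *)
Require Import Defs.
From mathcomp Require Import all_boot all_order all_algebra.
From mathcomp Require Import zify ring lra.

(** The loops that start at times congruent to [g] modulo [m] never collide with
    the other loops, so each residue class [g < m] behaves as one processor of a
    parallel-machine problem, available from time [g] on.  A non-interruptive
    schedule runs each job [j], of length [m * L j], without preemption on one
    processor; an arbitrary schedule lets the jobs be preempted and migrate.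
    The theorem is thus a form of the fact that preemption does not help to
    minimize total weighted completion time on identical parallel machines.

    The start times of two processors differ by less than a loop, and an
    exchange of loops between them would create overlaps of fractions of a
    loop.  Hence the schedule is first relaxed to unit time steps: job [j] is
    busy at the steps [S j k <= t < S j k + m].  At each step a job is busy at
    most once, and at most as many jobs are busy at step [t] as there are
    processors [g <= t] ([busy_capacity]).  Beyond that, the relaxation forgets
    which processor a job uses.

    Preemption is then removed backwards in time ([preemption_useless]).
    Suppose that from step [s + 1] on every processor [g] works through a list
    of jobs from time [maxn s.+1 g], and let [X] be the set of jobs busy at
    step [s].  The jobs of [X] are absorbed one at a time, each paired with a
    processor [g <= s] ([absorb_job]).  A job that has no work left is put in
    front of the list of [g].  Otherwise the job [j] is in some list, followed
    by [l2], and there are two ways to proceed: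
    - let the list of [g] start at [s], and make [j] longer by one step where
      it is; the cost changes by [weight (j :: l2) - weight (plan g)];
    - exchange the list of [g] with the part [j :: l2], so that [j] starts at
      [s] on [g]; if [j] was to start [D] steps after [s + 1], the cost changes
      by [D * (weight (plan g) - weight (j :: l2))].
    These changes have opposite signs, so one of the two ways costs nothing.
    At [s = 0] only lists are left; they form a plan that costs no more than
    the schedule, and every plan is the non-interruptive schedule
    [plan_schedule] of the same cost.  As there are finitely many plans, a
    cheapest one exists. *)

Set Implicit Arguments.
Unset Strict Implicit.
Unset Printing Implicit Defensive.

Import Order.TTheory GRing.Theory Num.Theory.

(** * Plans: one list of jobs per processor *)

Definition upd (I : eqType) (T : Type) (f : I -> T) (g : I) (y : T) : I -> T :=
  fun h => if h == g then y else f h.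

Lemma upd_neq (I : eqType) (T : Type) (f : I -> T) g h y :
  h != g -> upd f g y h = f h.
Proof. by rewrite /upd => /negbTE ->. Qed.

Section Plans.

Variables (R : realFieldType) (m n : nat) (w : 'I_n -> R).
Hypothesis w_gt0 : forall j, (0 < w j)%R.

Implicit Types (r : 'I_n -> nat) (l : seq 'I_n) (f : 'I_m -> nat).
Implicit Types (plan : 'I_m -> seq 'I_n) (j : 'I_n) (g h : 'I_m).
Implicit Types (X : {set 'I_n}).

Definition work r l : nat := \sum_(j <- l) r j.
Definition weight l : R := (\sum_(j <- l) w j)%R.

(** Weighted completion times of the jobs of [l], processed one after the other
    from time [t] on, where [r j] is the time that [j] still needs. *)
Fixpoint list_cost r (t : nat) l : R :=
  if l is j :: l' then (w j * (t + r j)%:R + list_cost r (t + r j) l')%R else 0%R.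

Definition plan_cost r f plan : R := (\sum_g list_cost r (f g) (plan g))%R.

Definition occ j l : nat := count_mem j l.

(** The jobs in the lists are those that still need time; a job that occurs
    occurs only once, in only one list. *)
Definition covers r plan : Prop :=
  forall j, \sum_g occ j (plan g) = (0 < r j).

Lemma weight_ge0 l : (0 <= weight l)%R.
Proof. by apply: sumr_ge0 => j _; apply: ltW. Qed.

Lemma list_cost_cat r t l1 l2 :
  list_cost r t (l1 ++ l2) =
  (list_cost r t l1 + list_cost r (t + work r l1) l2)%R.
Proof.
elim: l1 t => [|j l1 IH] t /=; first by rewrite /work big_nil addn0 add0r.
by rewrite IH /work big_cons addnA addrA.
Qed.

(** The cost of a list is affine in its starting time, with the weight of the
    list as slope; the whole exchange argument rests on this. *)
Lemma list_cost_delay r t d l :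
  list_cost r (t + d) l = (list_cost r t l + d%:R * weight l)%R.
Proof.
elim: l t => [|j l IH] t /=; first by rewrite /weight big_nil mulr0 addr0.
rewrite addnAC IH /weight big_cons !natrD; ring.
Qed.

Lemma eq_list_cost r r' t l :
  {in l, r =1 r'} -> list_cost r t l = list_cost r' t l.
Proof.
elim: l t => //= j l IH t E; rewrite E ?mem_head // IH // => x xl.
by apply: E; rewrite inE xl orbT.
Qed.

Lemma eq_work r r' l : {in l, r =1 r'} -> work r l = work r' l.
Proof. by move=> E; apply: eq_big_seq. Qed.

Definition longer j r : 'I_n -> nat := fun x => r x + (x == j).

Lemma longer_notin j r l : j \notin l -> {in l, longer j r =1 r}.
Proof.
move=> jl x xl; rewrite /longer; case: eqP => [e|_]; last by rewrite addn0.
by rewrite -e xl in jl.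
Qed.

Lemma list_cost_longer j r t l :
  j \notin l -> list_cost (longer j r) t l = list_cost r t l.
Proof. by move=> jl; apply/eq_list_cost/longer_notin. Qed.

(** Starting the first job one step earlier pays for making it one step
    longer. *)
Lemma list_cost_head_longer j r t l :
  j \notin l -> list_cost (longer j r) t (j :: l) = list_cost r t.+1 (j :: l).
Proof.
by move=> jl; rewrite /= list_cost_longer // /longer eqxx addn1 addnS addSn.
Qed.

Lemma mem_occ j l : (j \in l) = (0 < occ j l).
Proof. by rewrite -has_pred1 has_count. Qed.

Lemma occ_cons j x l : occ j (x :: l) = (x == j) + occ j l.
Proof. by []. Qed.

Lemma occ_cat j l1 l2 : occ j (l1 ++ l2) = occ j l1 + occ j l2.
Proof. exact: count_cat. Qed.

Lemma sum_occ_upd j plan g l :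
  \sum_h occ j (upd plan g l h) + occ j (plan g) =
  \sum_h occ j (plan h) + occ j l.
Proof.
rewrite (bigD1 g) //= [in RHS](bigD1 g) //= /upd eqxx.
rewrite (eq_bigr (fun h => occ j (plan h))); first by lia.
by move=> h /negbTE ->.
Qed.

Lemma covers_gt0 r plan j h : covers r plan -> j \in plan h -> 0 < r j.
Proof.
move=> cov; rewrite mem_occ => jh.
by have := cov j; rewrite (bigD1 h) //=; case: (0 < r j) => //; lia.
Qed.

Lemma covers_split r plan j :
  covers r plan -> 0 < r j -> exists h l1 l2, plan h = l1 ++ j :: l2.
Proof.
move=> cov rj; have : \sum_g occ j (plan g) != 0 by rewrite cov rj.
rewrite sum_nat_eq0 negb_forall => /existsP[h /=]; rewrite -lt0n -mem_occ.
move=> jh; exists h; case: (plan h) / (path.splitPr jh) => l1 l2.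
by exists l1, l2.
Qed.

Lemma covers_once r plan j h l1 l2 :
  covers r plan -> plan h = l1 ++ j :: l2 ->
  [/\ j \notin l1, j \notin l2 & forall g, g != h -> j \notin plan g].
Proof.
move=> cov E.
have := cov j; rewrite (bigD1 h) //= E occ_cat occ_cons eqxx => C.
have [C1 C2 C3] : [/\ occ j l1 = 0, occ j l2 = 0 &
    \sum_(i < m | i != h) occ j (plan i) = 0].
  have : occ j l1 + (1 + occ j l2) + \sum_(i < m | i != h) occ j (plan i) <= 1.
    by rewrite C leq_b1.
  by move: (occ j l1) (occ j l2) (\sum_(_ < _ | _) _) => a b c; split; lia.
split; rewrite ?mem_occ ?C1 ?C2 // => g gh.
move/eqP: C3; rewrite sum_nat_eq0 => /forallP/(_ g)/implyP/(_ gh)/eqP.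
by rewrite mem_occ => ->.
Qed.

(** * Removing preemption backwards in time *)

Lemma plan_cost_upd r f plan g t l :
  plan_cost r (upd f g t) (upd plan g l) =
  (plan_cost r f plan + (list_cost r t l - list_cost r (f g) (plan g)))%R.
Proof.
rewrite /plan_cost (bigD1 g) //= [in RHS](bigD1 g) //= /upd eqxx.
rewrite (eq_bigr (fun h => list_cost r (f h) (plan h))); last first.
  by move=> h /negbTE ->.
ring.
Qed.

Lemma upd_id (T : Type) (F : 'I_m -> T) g : upd F g (F g) =1 F.
Proof. by move=> h; rewrite /upd; case: eqP => // ->. Qed.

Lemma plan_cost_upd_start r f plan g t :
  plan_cost r (upd f g t) plan =
  (plan_cost r f plan + (list_cost r t (plan g) - list_cost r (f g) (plan g)))%R.
Proof.
rewrite -plan_cost_upd; apply: eq_bigr => h _; by rewrite upd_id.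
Qed.

Lemma plan_cost_upd_list r f plan g l :
  plan_cost r f (upd plan g l) =
  (plan_cost r f plan + (list_cost r (f g) l - list_cost r (f g) (plan g)))%R.
Proof.
rewrite -plan_cost_upd; apply: eq_bigr => h _; by rewrite upd_id.
Qed.

Lemma plan_cost_longer j r f plan g :
  (forall h, h != g -> j \notin plan h) ->
  plan_cost (longer j r) f plan =
  (plan_cost r f plan + (list_cost (longer j r) (f g) (plan g)
                         - list_cost r (f g) (plan g)))%R.
Proof.
move=> jh; rewrite /plan_cost (bigD1 g) //= [in RHS](bigD1 g) //=.
rewrite (eq_bigr (fun h => list_cost r (f h) (plan h))); last first.
  by move=> h hg; rewrite list_cost_longer ?jh.
ring.
Qed.

(** The state while step [s] is being absorbed: the lists of the processors
    that already got their job start at [s], the others later, and [X] is the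
    set of jobs of step [s] still to be absorbed.  If a job of [X] led a list
    that starts at [s], it would have to run twice at step [s]. *)
Definition ready s f plan X : Prop :=
  forall h, s <= f h /\ (f h = s -> forall x l, plan h = x :: l -> x \notin X).

(** The exchange step.  When [j] has work left, it is either lengthened in place
    or moved to [g] together with its followers; the two changes of cost have
    opposite signs.  The last hypothesis, that a job of [X] at the head of the
    list of [g] is [j] itself, keeps the state [ready]: after the first
    alternative this head starts at [s].  A job without work left completes at
    time [s.+1], which accounts for the extra cost. *)
Lemma absorb_job s f r plan X g j :
    covers r plan -> ready s f plan X -> f g = s.+1 -> j \in X ->
    (forall x l, plan g = x :: l -> x \in X -> x = j) ->
  exists plan', [/\ covers (longer j r) plan',
    ready s (upd f g s) plan' (X :\ j) &
    (plan_cost (longer j r) (upd f g s) plan' <=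
     plan_cost r f plan + (if r j == 0 then w j * s.+1%:R else 0))%R].
Proof.
move=> cov rdy fg jX hd.
have [rj0|rj] := posnP (r j).
  have jN h : j \notin plan h.
    by apply/negP => /(covers_gt0 cov); rewrite rj0.
  exists (upd plan g (j :: plan g)); split.
  - move=> x; apply: (@addIn (occ x (plan g))).
    rewrite sum_occ_upd cov occ_cons addnA [j == x]eq_sym /longer.
    by case: eqP => [->|_]; rewrite ?rj0 ?addn0.
  - move=> h; rewrite /upd; case: eqP => [_|_]; last first.
      by have [? H] := rdy h; split => // /H K x l /K; rewrite !inE negb_and => ->; rewrite orbT.
    by split => // _ x l [<- _]; rewrite !inE eqxx.
  - rewrite plan_cost_upd (@plan_cost_longer _ _ _ _ g) // list_cost_head_longer //.
    rewrite list_cost_longer //= fg rj0 addn0; lra.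
have [h0 [l1 [l2 E]]] := covers_split cov rj.
have [j1 j2 jN] := covers_once cov E.
(* [j] starts at [s.+1] or later: it cannot lead a list that starts at [s], and
   a job in front of it takes at least one step. *)
have late : s < f h0 + work r l1.
  have [le hdN] := rdy h0; case: l1 E {j1} => [|x l1] E /=.
    rewrite /work big_nil addn0 ltn_neqAle le andbT; apply/eqP => e.
    by have /negP := hdN (esym e) _ _ E; apply.
  have rx : 0 < r x by apply: (covers_gt0 (h := h0) cov); rewrite E mem_head.
  by rewrite /work big_cons; lia.
have tail_longer : plan_cost (longer j r) f plan =
    (plan_cost r f plan + weight (j :: l2))%R.
  rewrite (plan_cost_longer r f jN) E !list_cost_cat list_cost_longer //.
  rewrite list_cost_head_longer // (eq_work (longer_notin _ j1)).
  rewrite -addn1 list_cost_delay; lra.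
have keep : ready s (upd f g s) plan (X :\ j).
  move=> h; rewrite /upd; case: eqP => [->|_].
    split=> // _ x l /hd; rewrite !inE => K; apply/negP => /andP[/eqP xj /K].
    by move/xj.
  by have [? H] := rdy h; split => // /H K x l /K; rewrite !inE negb_and => ->; rewrite orbT.
have cov_longer : covers (longer j r) plan.
  by move=> x; rewrite cov /longer; case: eqP => [->|_]; rewrite ?addn0 // addn1 rj.
rewrite addr0.
(* Lengthening [j] delays itself and [l2]; starting the list of [g] at [s]
   advances all of that list. *)
have [light|heavy] := lerP (weight (j :: l2)) (weight (plan g)).
  exists plan; split=> //; rewrite plan_cost_upd_start tail_longer fg.
  rewrite -addn1 list_cost_delay; lra.
(* Otherwise [j :: l2] and the list of [g] trade places; this needs two
   different lists, and a list weighs no less than its end segment [j :: l2]. *)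
have gh : g != h0.
  apply: contraTneq heavy => ->; rewrite E -leNgt {2}/weight big_cat /=.
  by rewrite lerDr weight_ge0.
exists (upd (upd plan h0 (l1 ++ plan g)) g (j :: l2)); split.
- move=> x; rewrite -cov_longer.
  have := sum_occ_upd x (upd plan h0 (l1 ++ plan g)) g (j :: l2).
  have := sum_occ_upd x plan h0 (l1 ++ plan g).
  rewrite (upd_neq _ _ gh) E !occ_cat.
  move: (\sum_h _) (\sum_h _) (\sum_h _); lia.
- move=> h; have := keep h; rewrite /upd; case: eqP => [_ _|/eqP hg].
    by split=> // _ x l [<- _]; rewrite !inE eqxx.
  case: eqP => [->|//] [le K]; split => // /[dup] e /K {}K x l E'.
  case: l1 E j1 late E' => [|y l1] E j1 late; last first.
    by case=> <- _; apply: K; rewrite E.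
  by rewrite /work big_nil e addn0 ltnn in late.
rewrite plan_cost_upd plan_cost_upd_list tail_longer (upd_neq _ _ gh) fg.
rewrite E !list_cost_cat !(list_cost_head_longer _ _ j2).
rewrite !(list_cost_longer _ _ j1) !(list_cost_longer _ _ (jN g gh)).
rewrite (eq_work (longer_notin _ j1)).
move: late => /subnKC <-; set D := (_ - _)%N.
rewrite -[(s.+1 + D).+1]addn1 !list_cost_delay mul1r.
have : (D%:R * weight (plan g) <= D%:R * weight (j :: l2))%R.
  by rewrite ler_wpM2l // ltW.
lra.
Qed.

Lemma eq_plan_cost r r' f f' plan :
  r =1 r' -> f =1 f' -> plan_cost r f plan = plan_cost r' f' plan.
Proof.
by move=> er ef; apply: eq_bigr => g _; rewrite ef; apply: eq_list_cost => x _.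
Qed.

(** Absorbing all of step [s]: [M] is the set of processors whose lists have yet
    to be extended from [s.+1] back to [s].  Processors left over when [X] is
    exhausted start their lists earlier, which is no loss.  The functions [r']
    and [f'] are given pointwise so that the induction needs no functional
    extensionality. *)
Lemma absorb_step s f r plan X (M : {set 'I_m}) r' f' :
    covers r plan -> ready s f plan X -> (forall g, g \in M -> f g = s.+1) ->
    #|X| <= #|M| ->
    (forall j, r' j = r j + (j \in X)) ->
    (forall g, f' g = if g \in M then s else f g) ->
  exists2 plan', covers r' plan' &
    (plan_cost r' f' plan' <=
     plan_cost r f plan + \sum_(j in X | r j == 0) w j * s.+1%:R)%R.
Proof.
move: {2}#|M| (erefl #|M|) => c.
elim: c M X r f plan => [|c IH] M X r f plan cM cov rdy fM leXM er ef.
  have X0 : X = set0 by apply/eqP; rewrite -cards_eq0 -leqn0 -cM.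
  have M0 : M = set0 by apply/eqP; rewrite -cards_eq0 cM.
  have {}er : r =1 r' by move=> j; rewrite er X0 inE addn0.
  have {}ef : f =1 f' by move=> g; rewrite ef M0 inE.
  exists plan; first by move=> j; rewrite -er.
  rewrite X0 big_pred0; last by move=> j; rewrite inE.
  by rewrite addr0 (eq_plan_cost _ er ef).
have /card_gt0P[g gM] : 0 < #|M| by rewrite cM.
have cMg : #|M :\ g| = c by move: cM; rewrite (cardsD1 g) gM => -[].
have fMg h : h \in M :\ g -> upd f g s h = s.+1.
  by rewrite !inE => /andP[hg hM]; rewrite upd_neq ?fM.
have ef' h : f' h = if h \in M :\ g then s else upd f g s h.
  by rewrite ef !inE /upd; case: eqP => // ->; rewrite gM.
have [X0|[x xX]] := set_0Vmem X.
  have rdy0 : ready s (upd f g s) plan set0.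
    move=> h; split=> [|_ x l _]; last by rewrite inE.
    by rewrite /upd; case: eqP => // _; case: (rdy h).
  have le0 : #|set0 : {set 'I_n}| <= #|M :\ g| by rewrite cards0.
  have er0 j : r' j = r j + (j \in set0) by rewrite er X0.
  have [plan' cov' le'] := IH _ _ _ _ _ cMg cov rdy0 fMg le0 er0 ef'.
  exists plan' => //; apply: le_trans le' _.
  rewrite X0 lerD2r plan_cost_upd_start fM // -addn1 list_cost_delay.
  have := weight_ge0 (plan g); lra.
(* If the list of [g] starts with a job of [X], that job has to be taken. *)
have [j jX hd] : exists2 j, j \in X &
    forall x l, plan g = x :: l -> x \in X -> x = j.
  case E: (plan g) => [|y l]; first by exists x.
  have [yX|yX] := boolP (y \in X); first by exists y => // ? ? [<-].
  by exists x => // ? ? [<-]; rewrite (negbTE yX).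
have [plan1 [cov1 rdy1 le1]] := absorb_job cov rdy (fM g gM) jX hd.
have leX1 : #|X :\ j| <= #|M :\ g|.
  by move: leXM; rewrite cMg cM (cardsD1 j) jX.
have er1 i : r' i = longer j r i + (i \in X :\ j).
  by rewrite er !inE /longer; case: eqP => [->|]; rewrite ?jX /= ?addn0.
have [plan' cov' le'] := IH _ _ _ _ _ cMg cov1 rdy1 fMg leX1 er1 ef'.
exists plan' => //; apply: le_trans le' _.
have -> : (\sum_(i in X | r i == 0) w i * s.+1%:R =
  (if r j == 0 then w j * s.+1%:R else 0) +
   \sum_(i in X :\ j | longer j r i == 0) w i * s.+1%:R)%R.
  rewrite big_mkcondr (bigD1 j) //= -big_mkcondr; congr (_ + _)%R.
  apply: eq_bigl => i; rewrite !inE /longer.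
  by case: (i == j); rewrite ?andbF //= andbT addn0.
by rewrite addrA lerD2r.
Qed.

(** Jobs that are busy at arbitrary steps, within the number of available
    processors, can be run without preemption at no greater cost.  In the
    backward induction, the lists at time [s] are compared with the jobs still
    unfinished at [s] only; the jobs that finish at [s.+1] join the comparison
    in the step from [s.+1] to [s], with the cost that [absorb_step] charges. *)
Lemma preemption_useless (b : 'I_n -> nat -> bool) (C : 'I_n -> nat) H :
    (forall j t, b j t -> t < C j) -> (forall j, C j <= H) ->
    (forall t, #|[set j | b j t]| <= #|[set g : 'I_m | g <= t]|) ->
  exists2 plan, covers (fun j => \sum_(0 <= t < H) b j t) plan &
    (plan_cost (fun j => \sum_(0 <= t < H) b j t)%N (@nat_of_ord m) plan
      <= \sum_j w j * (C j)%:R)%R.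
Proof.
move=> bC CH cap.
pose rem s j := \sum_(s <= t < H) b j t.
have main d s : s + d = H -> exists2 plan, covers (rem s) plan &
    (plan_cost (rem s) (fun g => maxn s g) plan
      <= \sum_(j | (0 < rem s j)%N) w j * (C j)%:R)%R.
  elim: d s => [|d IH] s; first rewrite addn0 => ->.
    have rem0 j : rem H j = 0 by rewrite /rem big_geq.
    exists (fun=> [::]); first by move=> j; rewrite rem0 big1.
    rewrite /plan_cost big1 // big_pred0 // => j; by rewrite rem0.
  move=> sH; have [|plan cov le] := IH s.+1; first by rewrite addSnnS.
  have sltH : s < H by lia.
  have remS j : rem s j = rem s.+1 j + b j s by rewrite /rem big_ltn // addnC.
  pose X := [set j | b j s]; pose M := [set g : 'I_m | g <= s].
  have rdy : ready s (fun g => maxn s.+1 g) plan X.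
    by move=> h; split=> [|e]; lia.
  have fM (g : 'I_m) : g \in M -> maxn s.+1 g = s.+1 by rewrite inE; lia.
  have er j : rem s j = rem s.+1 j + (j \in X) by rewrite remS inE.
  have ef (g : 'I_m) : maxn s g = if g \in M then s else maxn s.+1 g.
    by rewrite inE; case: ifP; lia.
  have [plan' cov' le'] := absorb_step cov rdy fM (cap s) er ef.
  exists plan' => //; apply: le_trans le' _; apply: le_trans (lerD le (lexx _)) _.
  rewrite big_mkcond [X in (_ + X)%R]big_mkcond [leRHS]big_mkcond -big_split.
  apply: ler_sum => j _; rewrite /= inE remS.
  have wC t : t <= C j -> (w j * t%:R <= w j * (C j)%:R)%R.
    by move=> tC; rewrite ler_pM2l ?w_gt0 // ler_nat.
  have := bC j s; have := wC 0 isT; rewrite mulr0.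
  case: (b j s) => /= [C0 /(_ isT) /wC|C0 _]; rewrite ?addn1 ?addn0.
    by case: posnP; rewrite /= ?addr0 ?add0r.
  by case: posnP; rewrite /= ?addr0.
have [plan cov le] := main H 0 (add0n H).
have max0 : @nat_of_ord m =1 fun g => maxn 0 g by move=> g; rewrite max0n.
rewrite -(eq_plan_cost _ (frefl (rem 0)) max0) in le.
exists plan => //.
apply: (le_trans le); rewrite big_mkcond; apply: ler_sum => j _.
by case: ifP => // _; rewrite mulr_ge0 // ltW.
Qed.

(** * Start times in a plan *)

Lemma covers_list_uniq r plan g : covers r plan -> uniq (plan g).
Proof.
move=> cov; apply: count_mem_uniq => j; rewrite -/(occ j (plan g)) mem_occ.
have := cov j; rewrite (bigD1 g) //=; case: (0 < r j) => //; lia.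
Qed.

Lemma sum_list_occ (F : 'I_n -> R) l :
  (\sum_(j <- l) F j = \sum_j F j *+ occ j l)%R.
Proof.
elim: l => [|x l IH]; first by rewrite big_nil big1.
rewrite big_cons IH.
under [in RHS]eq_bigr => j _ do rewrite occ_cons mulrnDr.
rewrite big_split /= [X in (_ = X + _)%R](bigD1 x) //= eqxx.
rewrite [X in (_ = _ + X + _)%R]big1 ?addr0 // => j.
by rewrite eq_sym => /negbTE ->.
Qed.

(** In a plan that covers [j] the sum has a single term, as [startE] shows. *)
Definition start r plan j : nat :=
  \sum_(g | j \in plan g) (g + work r (take (index j (plan g)) (plan g))).

Lemma startE r r' plan j g l1 l2 : covers r' plan -> plan g = l1 ++ j :: l2 ->
  start r plan j = g + work r l1.
Proof.
move=> cov E; have [j1 _ jN] := covers_once cov E.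
rewrite /start (big_pred1 g) => [|h].
  by rewrite E index_cat (negbTE j1) /= eqxx addn0 take_size_cat.
rewrite /= ; case: eqVneq => [->|/jN/negbTE //].
by rewrite E mem_cat mem_head orbT.
Qed.

Lemma plan_cost_start r plan : covers r plan -> (forall j, 0 < r j) ->
  plan_cost r (@nat_of_ord m) plan =
  (\sum_j w j * (start r plan j + r j)%:R)%R.
Proof.
move=> cov r0; pose F j := (w j * (start r plan j + r j)%:R)%R.
have listE g : list_cost r g (plan g) = (\sum_(j <- plan g) F j)%R.
  have aux l2 : forall l1, plan g = l1 ++ l2 ->
      list_cost r (g + work r l1) l2 = (\sum_(j <- l2) F j)%R.
    elim: l2 => [|j l2 IH] l1 E; first by rewrite big_nil.
    rewrite big_cons /= -(startE r cov E); congr (_ + _)%R.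
    rewrite -(IH (rcons l1 j)) ?cat_rcons //.
    by rewrite (startE r cov E) /work -cats1 big_cat big_seq1 addnA.
  by rewrite -(aux _ [::]) // /work big_nil addn0.
rewrite /plan_cost (eq_bigr _ (fun g _ => listE g)).
under eq_bigr => g _ do rewrite sum_list_occ.
rewrite exchange_big; apply: eq_bigr => j _ /=.
by rewrite sumrMnr cov r0.
Qed.

(** Two jobs on the same processor do not overlap.  The offsets are kept in the
    form [work r l] because the comparison of residues modulo [m] needs that
    they are sums of job lengths. *)
Lemma starts_apart r plan j j' :
    covers r plan -> (forall j, 0 < r j) -> j != j' ->
  exists g g' l l', [/\ start r plan j = g + work r l,
    start r plan j' = g' + work r l' &
    g = g' -> work r l + r j <= work r l' \/ work r l' + r j' <= work r l].
Proof.
move=> cov r0 jj'.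
have [g [l1 [l2 E]]] := covers_split cov (r0 j).
have [g' [k1 [k2 E']]] := covers_split cov (r0 j').
exists g, g', l1, k1.
split; rewrite ?(startE r cov E) ?(startE r cov E') // => eg; subst g'.
have : j' \in plan g by rewrite E' mem_cat mem_head orbT.
rewrite E mem_cat inE eq_sym (negbTE jj') /= => /orP[] /path.splitPr K.
  right; case: K E => a b E; rewrite -catA in E.
  have /addnI -> := etrans (esym (startE r cov E')) (startE r cov E).
  by rewrite /work big_cat big_cons /= addnA leq_addr.
left; case: K E => a b E; rewrite -cat_cons catA in E.
have /addnI -> := etrans (esym (startE r cov E')) (startE r cov E).
by rewrite /work big_cat big_cons /= addnA leq_addr.
Qed.

End Plans.

(** * Plans as non-interruptive schedules *)

Section Shop.

Variables (m n : nat) (L : 'I_n -> nat).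
Hypothesis m_gt0 : 0 < m.
Hypothesis L_gt0 : forall j, 0 < L j.

Implicit Types (j : 'I_n) (S : start_times n) (plan : 'I_m -> seq 'I_n).

Definition job_length j : nat := m * L j.

Lemma job_length_gt0 j : 0 < job_length j.
Proof. by rewrite muln_gt0 m_gt0 L_gt0. Qed.

Definition plan_schedule plan : start_times n :=
  fun j k => start job_length plan j + k.-1 * m.

(** All loops on processor [g] start at times congruent to [g] modulo [m], so
    loops on different processors cannot start together. *)
Lemma plan_schedule_valid plan :
  covers job_length plan -> is_schedule m L (plan_schedule plan).
Proof.
move=> cov; split=> [j k j' k' /andP[k0 kL] /andP[k'0 k'L] ne|j [|[|k]] //]; last first.
  by move=> _; rewrite /loop_completion /plan_schedule /= -addnA -mulSnr.
rewrite /plan_schedule; have [e|jj'] := eqVneq j j'.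
  subst j' => /addnI/eqP; rewrite eqn_pmul2r // => /eqP e.
  by apply: ne; congr (_, _); lia.
have [g [g' [l [l' [-> -> apart]]]]] := starts_apart cov job_length_gt0 jj'.
have workE (q : seq 'I_n) : work job_length q = work L q * m.
  by rewrite /work big_distrl; apply: eq_bigr => i _; rewrite /job_length mulnC.
move: apart; rewrite !workE /job_length -!addnA -!mulnDl => apart e.
have eg : g = g'.
  apply: val_inj; have /(congr1 (modn^~ m)) := e.
  by rewrite !(addnC (nat_of_ord _)) !modnMDl !modn_small.
move: apart e => /(_ eg); rewrite eg => apart /addnI/eqP.
rewrite eqn_pmul2r // => /eqP e.
move: apart; rewrite !(mulnC m) -!mulnDl !leq_pmul2r //; lia.
Qed.

Lemma plan_schedule_non_interruptive plan : non_interruptive m L (plan_schedule plan).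
Proof.
by move=> j [|[|k]] // _; rewrite /loop_completion /plan_schedule /= -addnA -mulSnr.
Qed.

Lemma plan_schedule_cost (R : realFieldType) (w : 'I_n -> R) plan :
  covers job_length plan ->
  total_weighted_completion m L w (plan_schedule plan) =
  plan_cost w job_length (@nat_of_ord m) plan.
Proof.
move=> cov; rewrite (plan_cost_start w cov job_length_gt0).
apply: eq_bigr => j _; congr (_ * _%:R)%R.
rewrite /job_completion /loop_completion /plan_schedule -addnA -mulSnr.
by rewrite prednK // mulnC.
Qed.

(** * Schedules as preemptive schedules in unit steps *)

Definition busy S j t : bool :=
  [exists k : 'I_(L j), S j k.+1 <= t < S j k.+1 + m].

Section Schedule.

Variable S : start_times n.
Hypothesis S_ok : is_schedule m L S.

Lemma loops_apart j k k' : 0 < k -> k < k' -> k' <= L j -> S j k + m <= S j k'.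
Proof.
move=> k0; elim: k' => // k' IH; rewrite ltnS leq_eqVlt => /orP[/eqP <-|kk'] k'L.
  by case: S_ok => _ /(_ j k.+1); apply; lia.
have := IH kk' (ltnW k'L); have [_ /(_ j k'.+1)] := S_ok.
rewrite /loop_completion /=; lia.
Qed.

(** The loops of a job do not overlap, so at most one term of the sum is 1; this
    makes the busy steps countable loop by loop. *)
Lemma busyE j t :
  busy S j t = \sum_(k < L j) (S j k.+1 <= t < S j k.+1 + m) :> nat.
Proof.
rewrite /busy; case: existsP => [[k kt]|none]; last first.
  by rewrite big1 // => k _; case: (boolP (_ && _)) => // kt; case: none; exists k.
rewrite (bigD1 k) //= kt big1 // => k' kk'.
have /orP[lt|lt] : (k < k') || (k' < k) by rewrite -neq_ltn eq_sym.
- have := @loops_apart j k.+1 k'.+1 isT lt (ltn_ord k'); lia.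
- have := @loops_apart j k'.+1 k.+1 isT lt (ltn_ord k); lia.
Qed.

Lemma busy_lt j t : busy S j t -> t < job_completion m L S j.
Proof.
case/existsP => k /andP[_ tk]; apply: (leq_trans tk).
rewrite /job_completion /loop_completion leq_add2r.
have := ltn_ord k; rewrite leq_eqVlt => /orP[/eqP -> //|kL].
by have := @loops_apart j k.+1 (L j) isT kL (leqnn _); lia.
Qed.

Lemma sum_window H a : a + m <= H -> \sum_(0 <= t < H) (a <= t < a + m) = m.
Proof.
move=> aH; rewrite (big_cat_nat (n := a)) //=; last by lia.
rewrite [X in _ + X](big_cat_nat (n := a + m)) //=; last by lia.
rewrite !big_nat [X in X + _]big1 => [|t]; last by lia.
rewrite [X in _ + (_ + X)]big1 => [|t]; last by lia.
rewrite (eq_bigr (fun=> 1)) => [|t ->] //.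
by rewrite -big_nat sum_nat_const_nat; lia.
Qed.

Lemma busy_total H j : job_completion m L S j <= H ->
  \sum_(0 <= t < H) busy S j t = job_length j.
Proof.
move=> CH; rewrite (eq_bigr _ (fun t _ => busyE j t)) exchange_big /=.
rewrite (eq_bigr (fun=> m)) => [|k _]; first by rewrite sum_nat_const card_ord mulnC.
apply: sum_window; apply: leq_trans CH.
have : busy S j (S j k.+1 + m.-1) by apply/existsP; exists k; lia.
by move/busy_lt; lia.
Qed.

(** Sending a busy job to the age [t - S j k] of its current loop is injective
    because start times are distinct; the age is below [m] and at most [t].
    The proof uses the inverse map [h], from ages to jobs. *)
Lemma busy_capacity t :
  #|[set j | busy S j t]| <= #|[set g : 'I_m | g <= t]|.
Proof.
pose h (g : 'I_m) := [pick j | [exists k : 'I_(L j), S j k.+1 + g == t]].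
have inj : injective (@Some 'I_n) by move=> ? ? [].
rewrite -(card_imset _ inj).
apply: leq_trans (leq_imset_card h _); apply/subset_leq_card/subsetP => o.
case/imsetP => j; rewrite inE => /existsP[k /andP[kt tk]] ->.
have lt : t - S j k.+1 < m by lia.
apply/imsetP; exists (Ordinal lt); first by rewrite inE /=; lia.
rewrite /h; case: pickP => [j' /existsP[k' /eqP /= e]|/(_ j)/negbT/negP[] /=]; last first.
  by apply/existsP; exists k; rewrite /=; lia.
congr Some; apply/eqP/negP => /negP jj'.
have [/(_ j k.+1 j' k'.+1) distinct _] := S_ok.
apply: distinct; rewrite /is_loop ?ltn_ord //; last by lia.
by case=> ej _; rewrite ej eqxx in jj'.
Qed.

End Schedule.

(** * Optimality *)

Lemma plan_dominates (R : realFieldType) (w : 'I_n -> R) S :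
    (forall j, 0 < w j)%R -> is_schedule m L S ->
  exists2 plan, covers job_length plan &
    (plan_cost w job_length (@nat_of_ord m) plan <= total_weighted_completion m L w S)%R.
Proof.
move=> w_gt0 S_ok; pose C := job_completion m L S.
have CH j : C j <= \max_i C i by apply: leq_bigmax.
have [plan cov le] := preemption_useless w_gt0 (busy_lt S_ok) CH (busy_capacity S_ok).
have totalE j : \sum_(0 <= t < \max_i C i) busy S j t = job_length j.
  exact: busy_total.
exists plan; first by move=> j; rewrite cov totalE.
apply: le_trans le; rewrite le_eqVlt; apply/orP; left; apply/eqP.
by apply: eq_plan_cost => // j; rewrite totalE.
Qed.

(** Lists in a plan have no repetitions, hence at most [n] entries, so plans can
    be coded in a finite type. *)
Lemma exists_best_plan (R : realFieldType) (w : 'I_n -> R) :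
  exists2 plan, covers job_length plan & forall plan', covers job_length plan' ->
    (plan_cost w job_length (@nat_of_ord m) plan <=
     plan_cost w job_length (@nat_of_ord m) plan')%R.
Proof.
pose code := {ffun 'I_m -> n.-bseq 'I_n}.
pose decode (c : code) (g : 'I_m) : seq 'I_n := c g.
pose ok (c : code) := [forall j, \sum_g occ j (decode c g) == (0 < job_length j)].
have okP c : reflect (covers job_length (decode c)) (ok c).
  by apply: (iffP forallP) => H j; apply/eqP.
have encode plan : covers job_length plan -> exists c, decode c =1 plan.
  move=> cov; exists [ffun g => insub_bseq n (plan g)] => g.
  rewrite /decode ffunE val_insubd ifT //.
  rewrite -[X in _ <= X](card_ord n); have /card_uniqP <- := covers_list_uniq g cov.
  exact: max_card.
pose plan0 (g : 'I_m) := if g == Ordinal m_gt0 then enum 'I_n else [::].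
have cov0 : covers job_length plan0.
  move=> j; rewrite job_length_gt0 (bigD1 (Ordinal m_gt0)) //= big1 => [|g /negbTE ng].
    by rewrite /plan0 eqxx /occ count_uniq_mem ?enum_uniq // mem_enum.
  by rewrite /plan0 ng.
have okc c plan : covers job_length plan -> decode c =1 plan -> ok c.
  by move=> cov e; apply/okP => j; rewrite -cov; apply: eq_bigr => g _; rewrite e.
have [c0 /(okc _ _ cov0) ok0] := encode _ cov0.
case: (arg_minP (fun c => plan_cost w job_length (@nat_of_ord m) (decode c)) ok0).
move=> c /okP cov best; exists (decode c) => // plan cov'.
have [c' e] := encode _ cov'; have := best c' (okc _ _ cov' e).
suff -> : plan_cost w job_length (@nat_of_ord m) (decode c') =
  plan_cost w job_length (@nat_of_ord m) plan by [].
by apply: eq_bigr => g _; rewrite e.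
Qed.

End Shop.

Theorem theorem3p6 (R : realFieldType) (m n : nat) (L : 'I_n -> nat)
    (w : 'I_n -> R)
    (hm : 1 <= m)
    (hL : forall j : 'I_n, 1 <= L j)
    (hw : forall j : 'I_n, (0 < w j)%R) :
  exists S : start_times n,
    [/\ is_schedule m L S,
        non_interruptive m L S
      & forall S' : start_times n, is_schedule m L S' ->
          (total_weighted_completion m L w S
             <= total_weighted_completion m L w S')%R].
Proof.
have [plan cov best] := exists_best_plan hm hL w.
exists (plan_schedule L plan); split.
- exact: plan_schedule_valid.
- exact: plan_schedule_non_interruptive.
move=> S' /(plan_dominates hm hw)[plan' cov' le].
rewrite plan_schedule_cost //; exact: le_trans (best _ cov') le.
Qed.
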